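(* Let $[A]$ be an interval matrix of size $n\times n$ and let $K,L\in\mathbb{N}$ be such that $(K+2)\,2^L>\|[A]\|$. Then $$\{\exp(A):A\in[A]\}\subseteq[\mathcal{S}]([A],L,K).$$
   Context: Interval: a set $[x]=[\underline{x},\overline{x}]=\{x\in\mathbb{R}:\underline{x}\le x\le\overline{x}\}$ with real $\underline{x}\le\overline{x}$; a real number $x$ is identified with $[x,x]$. Interval arithmetic (exact, no rounding): for $\circ\in\{+,-,\times,\div\}$, $[x]\circ[y]=\{x\circ y:x\in[x],y\in[y]\}$ (for division, $0\notin[y]$). An $n\times n$ interval matrix is $[A]=\{A\in\mathbb{R}^{n\times n}:\underline{A}\le A\le\overline{A}\}$ for real matrices $\underline{A}\le\overline{A}$ (entrywise), equivalently a matrix of intervals $([a_{ij}])$ with $[a_{ij}]=[\underline{a}_{ij},\overline{a}_{ij}]$; a real matrix is identified with a degenerate interval matrix. Sums of interval matrices and products or quotients by scalars or intervals are entrywise, and the product is $([A][B])_{ij}=\sum_k[a_{ik}][b_{kj}]$, all in interval arithmetic. $\|\cdot\|$ is the infinity norm (maximum absolute row sum) for real matrices, and $\|[A]\|=\max\{\|A\|:A\in[A]\}$, which equals $\|\,|[A]|\,\|$ where $|[A]|$ is the real matrix with entries $\max\{|\underline{a}_{ij}|,|\overline{a}_{ij}|\}$. For an interval matrix $[M]$ with $K+2>\|[M]\|$ define, with $I$ the identity matrix and $E\in\mathbb{R}^{n\times n}$ the matrix with all entries equal to $1$, $$[\mathcal{R}]([M],K)=\rho(\|[M]\|,K)\,[-E,E],\qquad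 \rho(\alpha,K)=\frac{\alpha^{K+1}}{(K+1)!\,\bigl(1-\frac{\alpha}{K+2}\bigr)},$$ $$[\tilde{\mathcal{H}}]([M],K)=I+[M]\Bigl(I+\tfrac{[M]}{2}\Bigl(I+\tfrac{[M]}{3}\Bigl(\cdots\Bigl(I+\tfrac{[M]}{K}\Bigr)\cdots\Bigr)\Bigr)\Bigr),$$ evaluated in interval arithmetic in the nested order displayed (for $K=0$ it is read as $I$), and $$[\mathcal{H}]([M],K)=[\tilde{\mathcal{H}}]([M],K)+[\mathcal{R}]([M],K).$$ For $(K+2)2^L>\|[A]\|$ define $$[\mathcal{S}]([A],L,K)=\Bigl([\mathcal{H}]\bigl([A]/2^L,K\bigr)\Bigr)^{2^L},$$ where the power $2^L$ is computed by $L$ successive interval matrix squarings $[M]\mapsto[M][M]$ (interval matrix product). *)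

(* Defs.v *)
From HB Require Import structures.
From mathcomp Require Import all_boot all_order all_algebra.
From mathcomp Require Import all_classical all_reals all_analysis.

Set Implicit Arguments.
Unset Strict Implicit.
Unset Printing Implicit Defensive.

Import Order.TTheory GRing.Theory Num.Theory.
Import numFieldNormedType.Exports.

Local Open Scope classical_set_scope.
Local Open Scope ring_scope.

(** An interval is its set of points, and an interval matrix is a matrix of
    intervals. The arithmetic below is defined on arbitrary sets of reals; only
    the predicates [is_interval] and [is_interval_mx] require compact
    nonempty intervals. *)

Section IntervalArithmetic.
Context {R : realType}.
Implicit Types X Y : set R.

Definition is_interval X : Prop :=
  exists a b : R, a <= b /\ X = [set x | a <= x <= b].

Definition iadd X Y : set R := [set x + y | x in X & y in Y].
Definition imul X Y : set R := [set x * y | x in X & y in Y].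

(** Only meaningful when [0] is not in [Y], since [x / 0 = 0] here; it is used
    below with nonzero degenerate [Y] only. *)
Definition idiv X Y : set R := [set x / y | x in X & y in Y].

End IntervalArithmetic.

Section IntervalMatrices.
Context {R : realType} {n : nat}.
Implicit Types (A : 'M[R]_n) (M N : 'M[set R]_n).

Definition is_interval_mx M : Prop := forall i j, is_interval (M i j).

Definition mx_set M : set 'M[R]_n := [set A | forall i j, M i j (A i j)].

Definition imx_of A : 'M[set R]_n := \matrix_(i, j) [set A i j].

Definition imx_add M N : 'M[set R]_n := \matrix_(i, j) iadd (M i j) (N i j).

Definition imx_mul M N : 'M[set R]_n :=
  \matrix_(i, j) \big[iadd/[set 0]]_(k < n) imul (M i k) (N k j).

Definition imx_scale (c : R) M : 'M[set R]_n :=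
  \matrix_(i, j) imul [set c] (M i j).

Definition imx_div M (c : R) : 'M[set R]_n :=
  \matrix_(i, j) idiv (M i j) [set c].

Definition mx_norminf A : R := \big[Num.max/0]_(i < n) \sum_(j < n) `|A i j|.

(** For an interval matrix the supremum is a maximum, see [imx_norm_max]. *)
Definition imx_norm M : R := sup [set mx_norminf A | A in mx_set M].

Definition expmx A : 'M[R]_n :=
  limn (series (fun k : nat => k`!%:R^-1 *: A ^+ k)).

Definition rho (alpha : R) (K : nat) : R :=
  alpha ^+ K.+1 / (K.+1`!%:R * (1 - alpha / K.+2%:R)).

Definition remainder M (K : nat) : 'M[set R]_n :=
  imx_scale (rho (imx_norm M) K) (\matrix_(i, j) [set x | -1 <= x <= 1]).

(** [I + (M/1) (I + (M/2) (... (I + (M/K) I)))]: the outer quotient by [1] and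
    the inner product by [I] are the identity, see [imx_div1] and [imx_mul1]. *)
Definition horner M (K : nat) : 'M[set R]_n :=
  foldr (fun k N => imx_add (imx_of 1%:M) (imx_mul (imx_div M k%:R) N))
        (imx_of 1%:M) (iota 1 K).

Definition taylor M (K : nat) : 'M[set R]_n :=
  imx_add (horner M K) (remainder M K).

Definition scaling_squaring M (L K : nat) : 'M[set R]_n :=
  iter L (fun N => imx_mul N N) (taylor (imx_div M (2 ^+ L)) K).

End IntervalMatrices.

Section Facts.
Context {R : realType} {n : nat}.
Implicit Types (M : 'M[set R]_n).

Lemma iadd0X (X : set R) : iadd [set 0] X = X.
Proof.
apply/seteqP; split => [x [_ ->] [y Xy <-]|x Xx]; first by rewrite add0r.
by exists 0 => //; exists x => //; rewrite add0r.
Qed.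

Lemma iaddX0 (X : set R) : iadd X [set 0] = X.
Proof.
apply/seteqP; split => [x [y Xy] [_ -> <-]|x Xx]; first by rewrite addr0.
by exists x => //; exists 0 => //; rewrite addr0.
Qed.

Lemma imulX1 (X : set R) : imul X [set 1] = X.
Proof.
apply/seteqP; split => [x [y Xy] [_ -> <-]|x Xx]; first by rewrite mulr1.
by exists x => //; exists 1 => //; rewrite mulr1.
Qed.

Lemma imulX0 (X : set R) : X !=set0 -> imul X [set 0] = [set 0].
Proof.
case=> x0 Xx0; apply/seteqP; split => [x [y Xy] [_ -> <-]|x ->] /=.
  by rewrite mulr0.
by exists x0 => //; exists 0 => //; rewrite mulr0.
Qed.

Lemma imx_div1 M : imx_div M 1 = M.
Proof.
apply/matrixP => i j; rewrite mxE; apply/seteqP; split => [x [y My]|x Mx].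
  by case=> _ -> <-; rewrite divr1.
by exists x => //; exists 1 => //; rewrite divr1.
Qed.

Lemma is_interval_neq0 (X : set R) : is_interval X -> X !=set0.
Proof. by case=> a [b [ab ->]]; exists a => /=; rewrite lexx. Qed.

Lemma imx_mul1 M : is_interval_mx M -> imx_mul M (imx_of 1%:M) = M.
Proof.
move=> Mi; apply/matrixP => i j; rewrite mxE.
have big0 (s : seq 'I_n) : j \notin s ->
    \big[iadd/[set 0]]_(k <- s) imul (M i k) (imx_of 1%:M k j) = [set 0].
  elim: s => [|k s ih]; first by rewrite big_nil.
  rewrite inE negb_or big_cons => /andP[jk /ih ->].
  rewrite iaddX0 !mxE eq_sym (negbTE jk) imulX0//.
  exact/is_interval_neq0/Mi.
elim: (index_enum _) (index_enum_uniq 'I_n) (mem_index_enum j) => // k s ih.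
rewrite /= inE big_cons => /andP[ks us]; have [jk _|jk /= js] := eqVneq j k.
- by rewrite big0 ?jk// iaddX0 !mxE eqxx imulX1.
- rewrite ih// !mxE eq_sym (negbTE jk) imulX0 ?iadd0X//.
  exact/is_interval_neq0/Mi.
Qed.

Lemma imx_norm_max M : is_interval_mx M ->
  exists2 A, mx_set M A &
    imx_norm M = mx_norminf A /\
    forall B, mx_set M B -> mx_norminf B <= mx_norminf A.
Proof.
move=> Mi.
have mag i j : exists2 x, M i j x & forall y, M i j y -> `|y| <= `|x|.
  have [a [b [ab ->]]] := Mi i j.
  have yab y : a <= y <= b -> `|y| <= Num.max `|a| `|b|.
    move=> /andP[ay yb]; rewrite le_max.
    have [y0|/ltW y0] := leP 0 y.
      by rewrite ger0_norm// (le_trans yb (ler_norm b)) orbT.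
    by rewrite (ler0_norm y0) (ler0_norm (le_trans ay y0)) lerN2 ay.
  have [ab'|/ltW ba'] := leP `|a| `|b|.
    exists b => [|y /yab]; first by rewrite /= lexx andbT.
    by rewrite (max_idPr ab').
  exists a => [|y /yab]; first by rewrite /= lexx ab.
  by rewrite (max_idPl ba').
pose A := \matrix_(i, j) s2val (cid2 (mag i j)).
have MA : mx_set M A by move=> i j; rewrite mxE; case: cid2.
have Amax B : mx_set M B -> mx_norminf B <= mx_norminf A.
  move=> MB; apply: le_bigmax2 => i _; apply: ler_sum => j _.
  by rewrite mxE; case: cid2 => x /= _; apply; exact: MB.
exists A => //; split => //; apply/eqP; rewrite eq_le; apply/andP; split.
  by apply: ge_sup => [|_ [B MB <-]]; [exists (mx_norminf A), A|exact: Amax].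
apply: ub_le_sup; last by exists A.
by exists (mx_norminf A) => _ [B MB <-]; exact: Amax.
Qed.

End Facts.

(* Main.v *)
Require Import Defs.
From mathcomp Require Import all_boot all_order all_algebra.
From mathcomp Require Import all_classical all_reals all_analysis.

Set Implicit Arguments.
Unset Strict Implicit.
Unset Printing Implicit Defensive.

Import Order.TTheory GRing.Theory Num.Theory.
Import numFieldNormedType.Exports.

Local Open Scope classical_set_scope.
Local Open Scope ring_scope.

(** Interval arithmetic is inclusion isotone, so it suffices to treat one real
    matrix at a time. For a matrix [B] in [A / 2 ^ L], the Taylor sum of order
    [K] is enclosed by the interval Horner scheme, and each entry of the tail is
    at most [rho] by comparison with a geometric series of ratio
    [alpha / (K + 2)], [alpha] being the norm of the interval matrix. Since
    [exp (2 B) = exp B ^ 2], the [L] squarings enclose [exp (2 ^ L B)]. *)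

(** * The infinity norm: entry bounds, submultiplicativity, powers *)

Lemma mx_norminf_ge0 (R : realType) (n : nat) (A : 'M[R]_n) : 0 <= mx_norminf A.
Proof. exact: bigmax_ge_id. Qed.

Lemma mx_norminf_le (R : realType) (n : nat) (A : 'M[R]_n) (c : R) :
  0 <= c -> (forall i, \sum_(j < n) `|A i j| <= c) -> mx_norminf A <= c.
Proof. by move=> c0 Ac; apply: bigmax_le => // i _; exact: Ac. Qed.

Lemma row_sum_le_norminf (R : realType) (n : nat) (A : 'M[R]_n) (i : 'I_n) :
  \sum_(j < n) `|A i j| <= mx_norminf A.
Proof. exact: (le_bigmax _ (fun i => \sum_(j < n) `|A i j|)). Qed.

Lemma entry_le_norminf (R : realType) (n : nat) (A : 'M[R]_n) (i j : 'I_n) :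
  `|A i j| <= mx_norminf A.
Proof.
apply: le_trans (row_sum_le_norminf A i).
by rewrite (bigD1 j)//= lerDl sumr_ge0.
Qed.

Lemma mx_norminf1 (R : realType) (n : nat) : mx_norminf (1%:M : 'M[R]_n) <= 1.
Proof.
apply: mx_norminf_le => // i; rewrite (bigD1 i)//= big1 ?addr0.
  by rewrite mxE eqxx normr1.
by move=> j; rewrite eq_sym mxE => /negbTE ->; rewrite normr0.
Qed.

Lemma mx_norminfM (R : realType) (n : nat) (A B : 'M[R]_n) :
  mx_norminf (A *m B) <= mx_norminf A * mx_norminf B.
Proof.
apply: mx_norminf_le => [|i]; first by rewrite mulr_ge0 ?mx_norminf_ge0.
apply: (@le_trans _ _ (\sum_(k < n) `|A i k| * mx_norminf B)); last first.
  by rewrite -mulr_suml ler_wpM2r ?mx_norminf_ge0 ?row_sum_le_norminf.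
(* Summing over [j] first turns each inner sum into a row sum of [B]. *)
apply: (@le_trans _ _ (\sum_(k < n) \sum_(j < n) `|A i k| * `|B k j|)).
  rewrite exchange_big/=; apply: ler_sum => j _; rewrite mxE.
  by apply: le_trans (ler_norm_sum _ _ _) _; apply: ler_sum => k _; rewrite normrM.
by apply: ler_sum => k _; rewrite -mulr_sumr ler_wpM2l ?row_sum_le_norminf.
Qed.

Lemma mx_norminfX (R : realType) (n : nat) (A : 'M[R]_n) (k : nat) :
  mx_norminf (A ^+ k) <= mx_norminf A ^+ k.
Proof.
elim: k => [|k ih]; first exact: mx_norminf1.
rewrite !exprS; apply: le_trans (mx_norminfM _ _) _.
by rewrite ler_wpM2l ?mx_norminf_ge0.
Qed.

Lemma mx_norminfZ (R : realType) (n : nat) (c : R) (A : 'M[R]_n) :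
  0 <= c -> mx_norminf (c *: A) <= c * mx_norminf A.
Proof.
move=> c0; apply: mx_norminf_le => [|i]; first by rewrite mulr_ge0 ?mx_norminf_ge0.
under eq_bigr do rewrite mxE normrM (ger0_norm c0).
by rewrite -mulr_sumr ler_wpM2l ?row_sum_le_norminf.
Qed.

Lemma entryX_le (R : realType) (n : nat) (A : 'M[R]_n) (k : nat) (i j : 'I_n) :
  `|(A ^+ k) i j| <= mx_norminf A ^+ k.
Proof. exact: le_trans (entry_le_norminf _ _ _) (mx_norminfX _ _). Qed.

(** * Entrywise convergence of the exponential series *)

Lemma cvg_mx_coord (R : realType) (m n : nat) (u : nat -> 'M[R]_(m, n))
    (l : 'M[R]_(m, n)) :
  (forall i j, u k i j @[k --> \oo] --> l i j) -> u @ \oo --> l.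
Proof.
move=> ul; apply/cvgrPdist_le => e e0; near=> k.
(* The norm of the matrix topology is the largest absolute entry; there are finitely many entries,
   so one rank serves them all. *)
rewrite [leLHS]/Num.Def.normr/= mx_normrE (bigmax_le _ (ltW e0))//= => i _.
rewrite !mxE/=; move: i; near: k; apply: filter_forall => /= i.
by move/cvgrPdist_le : (ul i.1 i.2); exact.
Unshelve. all: by end_near. Qed.

(** The index counts terms, so the Taylor sum of order [K] is [expmx_psum A K.+1]. *)
Definition expmx_psum {R : realType} {n : nat} (A : 'M[R]_n) (m : nat) : 'M[R]_n :=
  \sum_(k < m) k`!%:R^-1 *: A ^+ k.

Lemma expmx_psum_series (R : realType) (n : nat) (A : 'M[R]_n) :
  series (fun k : nat => k`!%:R^-1 *: A ^+ k) = expmx_psum A.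
Proof. by apply/funext => m; rewrite /series/= big_mkord. Qed.

Lemma expmx_psum_coord (R : realType) (n : nat) (A : 'M[R]_n) i j :
  (fun m => expmx_psum A m i j) =
  series (fun k : nat => k`!%:R^-1 * (A ^+ k) i j).
Proof.
apply/funext => m; rewrite /series/= big_mkord summxE.
by apply: eq_bigr => k _; rewrite mxE.
Qed.

(** The bound [a] is kept free so that the norm of an enclosing interval matrix can stand for it. *)
Lemma expmx_term_le (R : realType) (n : nat) (A : 'M[R]_n) (a : R) i j k :
  mx_norminf A <= a -> `|k`!%:R^-1 * (A ^+ k) i j| <= exp_coeff a k.
Proof.
move=> Aa; rewrite normrM gtr0_norm ?invr_gt0 ?ltr0n ?fact_gt0// mulrC /exp_coeff/=.
rewrite ler_wpM2r ?invr_ge0//; apply: le_trans (entryX_le _ _ _ _) _.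
by rewrite lerXn2r// nnegrE ?mx_norminf_ge0// (le_trans (mx_norminf_ge0 A)).
Qed.

Lemma expmx_cvg (R : realType) (n : nat) (A : 'M[R]_n) i j :
  expmx_psum A m i j @[m --> \oo] --> expmx A i j.
Proof.
(* The candidate limit is built entry by entry, by comparison with the real series of [exp] at the
   norm; uniqueness of limits then identifies it with [expmx A]. *)
pose l : 'M[R]_n := \matrix_(i, j) limn (fun m => expmx_psum A m i j).
have psum_cvg i' j' : expmx_psum A m i' j' @[m --> \oo] --> l i' j'.
  rewrite mxE; suff : cvgn (fun m => expmx_psum A m i' j') by [].
  rewrite expmx_psum_coord; apply: normed_cvg.
  apply: series_le_cvg (is_cvg_series_exp_coeff (mx_norminf A)) => k //=.
    by rewrite exp_coeff_ge0 ?mx_norminf_ge0.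
  exact: expmx_term_le.
have <- : l = expmx A; last exact: psum_cvg.
apply/esym/cvg_lim; first exact: norm_hausdorff.
by rewrite expmx_psum_series; exact: cvg_mx_coord.
Qed.

(** * The tail of the series and [rho] *)

Lemma leq_fact_exp (K j : nat) : (K.+1`! * K.+2 ^ j <= (K.+1 + j)`!)%N.
Proof.
elim: j => [|j ih]; first by rewrite muln1 addn0.
(* The new factor of the factorial is at least [K.+2]. *)
rewrite addnS factS expnS mulnCA leq_mul//.
by rewrite addSn !ltnS leq_addr.
Qed.

Lemma sum_geometric_le (R : realFieldType) (q : R) (m : nat) :
  0 <= q -> q < 1 -> \sum_(j < m) q ^+ j <= (1 - q)^-1.
Proof.
move=> q0 q1; rewrite -[leRHS]div1r ler_pdivlMr ?subr_gt0//.
by rewrite mulrC -opprB mulNr -subrX1 opprB lerBlDr lerDl exprn_ge0.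
Qed.

Lemma exp_tail_le_rho (R : realType) (a : R) (K m : nat) :
  0 <= a -> a < K.+2%:R ->
  \sum_(K.+1 <= k < K.+1 + m) exp_coeff a k <= rho a K.
Proof.
move=> a0 aK.
rewrite -{1}[K.+1]add0n big_addn addKn big_mkord /rho.
have q0 : 0 <= a / K.+2%:R by rewrite divr_ge0.
have q1 : a / K.+2%:R < 1 by rewrite ltr_pdivrMr ?mul1r.
(* With the first term of the tail factored out, [leq_fact_exp] bounds what remains of each term by
   a power of [a / K.+2%:R]. *)
apply: (@le_trans _ _ (a ^+ K.+1 / K.+1`!%:R * \sum_(j < m) (a / K.+2%:R) ^+ j)).
  rewrite mulr_sumr; apply: ler_sum => j _; rewrite /exp_coeff/=.
  rewrite expr_div_n mulrACA -exprD addnC -invfM ler_wpM2l ?exprn_ge0//.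
  rewrite -natrX -natrM lef_pV2 ?posrE ?ltr0n ?fact_gt0 ?muln_gt0 ?expn_gt0 ?fact_gt0//.
  by rewrite ler_nat leq_fact_exp.
rewrite invfM mulrA ler_wpM2l ?divr_ge0 ?exprn_ge0//.
exact: sum_geometric_le.
Qed.

Lemma expmx_remainder (R : realType) (n : nat) (A : 'M[R]_n) (a : R) (K : nat) i j :
  mx_norminf A <= a -> a < K.+2%:R ->
  `|expmx A i j - expmx_psum A K.+1 i j| <= rho a K.
Proof.
move=> Aa aK; have a0 : 0 <= a by exact: le_trans (mx_norminf_ge0 A) Aa.
have cv : `|expmx_psum A m i j - expmx_psum A K.+1 i j| @[m --> \oo] -->
    `|expmx A i j - expmx_psum A K.+1 i j|.
  by apply: cvg_norm; apply: cvgB; [exact: expmx_cvg|exact: cvg_cst].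
(* The finite sections of the tail are bounded by [rho a K] uniformly in [m], and the bound passes
   to the limit. *)
rewrite -(cvg_lim (@norm_hausdorff _ _) cv).
apply: limr_le; first by apply/cvg_ex; eexists; exact: cv.
near=> m; have Km : (K.+1 <= m)%N by near: m; exact: nbhs_infty_ge.
have /(congr1 (fun f => (f m, f K.+1)))[-> ->] := expmx_psum_coord A i j.
rewrite sub_series_geq//; apply: le_trans (ler_norm_sum _ _ _) _.
rewrite -(subnKC Km); apply: le_trans (exp_tail_le_rho (m - K.+1) a0 aK).
by apply: ler_sum => k _; exact: expmx_term_le.
Unshelve. all: by end_near. Qed.

(** * The doubling formula, from truncated exponential polynomials evaluated at matrices and at
    reals *)

Definition exp_poly {R : realType} (c : R) (m : nat) : {poly R} :=
  \poly_(k < m) (c ^+ k / k`!%:R).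

Lemma horner_mx_sum (R : comNzRingType) (n : nat) (A : 'M[R]_n.+1) (p : {poly R}) :
  horner_mx A p = \sum_(k < size p) p`_k *: A ^+ k.
Proof.
rewrite -[in LHS](coefK p) poly_def linear_sum/=; apply: eq_bigr => k _.
by rewrite horner_mxZ rmorphXn/= horner_mx_X.
Qed.

Lemma horner_mx_exp_poly (R : realType) (n : nat) (A : 'M[R]_n.+1) (c : R) m :
  horner_mx A (exp_poly c m) = expmx_psum (c *: A) m.
Proof.
rewrite /exp_poly poly_def linear_sum/=; apply: eq_bigr => k _.
by rewrite horner_mxZ rmorphXn/= horner_mx_X exprZn scalerA mulrC.
Qed.

Lemma horner_exp_poly (R : realType) (c x : R) m :
  (exp_poly c m).[x] = series (exp_coeff (c * x)) m.
Proof.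
rewrite /series/= big_mkord horner_poly; apply: eq_bigr => k _.
by rewrite /exp_coeff/= exprMn mulrAC.
Qed.

(** Below degree [m] the binomial theorem makes the two coefficients agree; from degree [m] on, the
    second polynomial has coefficient 0 and the square is a sum of products of nonnegative
    numbers. *)
Lemma exp_poly_sqr_ge (R : realType) (m k : nat) :
  0 <= (exp_poly (1 : R) m ^+ 2 - exp_poly 2 m)`_k.
Proof.
rewrite coefB subr_ge0 coef_poly expr2 coefM.
case: ifPn => [km|_]; last first.
  apply: sumr_ge0 => j _; rewrite !coef_poly.
  by case: ifP => _; case: ifP => _; rewrite ?mulr0 ?mul0r// !expr1n mulr_ge0.
rewrite -[2]/(1 + 1 : R) exprDn mulr_suml; apply: ler_sum => j _.
have jk : (j <= k)%N by rewrite -ltnS.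
rewrite !coef_poly (leq_ltn_trans jk km) (leq_ltn_trans (leq_subr _ _) km).
rewrite !expr1n !mul1r -(bin_fact jk) !natrM 2!invfM !mulrA.
by rewrite divff ?mul1r// pnatr_eq0 -lt0n bin_gt0.
Qed.

Lemma horner_mx_le (R : realType) (n : nat) (A : 'M[R]_n.+1) (p : {poly R}) i j :
  (forall k, 0 <= p`_k) -> `|horner_mx A p i j| <= p.[mx_norminf A].
Proof.
move=> p0; rewrite horner_mx_sum horner_coef summxE.
apply: le_trans (ler_norm_sum _ _ _) _; apply: ler_sum => k _.
by rewrite mxE normrM ger0_norm// ler_wpM2l ?entryX_le.
Qed.

(* [P_m(X) ^ 2 - P_m(2 X)] has nonnegative coefficients, so its value at [A] is
   dominated by its value at the norm of [A], which tends to zero because the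
   real exponential is multiplicative. *)
Lemma expmx_sqr (R : realType) (n : nat) (A : 'M[R]_n) :
  expmx A *m expmx A = expmx (2 *: A).
Proof.
(* Polynomial evaluation is used in positive dimension; in dimension 0 all matrices are equal. *)
case: n A => [|n] A; first by rewrite [LHS]flatmx0 [RHS]flatmx0.
apply/matrixP => i j; apply/eqP; rewrite -subr_eq0 -normr_eq0; apply/eqP.
pose a := mx_norminf A.
pose d m := `|(expmx_psum A m *m expmx_psum A m) i j - expmx_psum (2 *: A) m i j|.
have dcv : d @ \oo --> `|(expmx A *m expmx A) i j - expmx (2 *: A) i j|.
  apply: cvg_norm; apply: cvgB; last exact: expmx_cvg.
  rewrite mxE; under eq_fun do rewrite mxE.
  by apply: cvg_big => [|k _]; [exact: add_continuous|apply: cvgM; exact: expmx_cvg].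
(* The quantity to annihilate is the limit of [d], which is squeezed between 0 and [e]. *)
rewrite -(cvg_lim (@norm_hausdorff _ _) dcv); apply/cvg_lim => //.
pose e m := series (exp_coeff a) m ^+ 2 - series (exp_coeff (2 * a)) m.
have ecv : e @ \oo --> (0 : R).
  have -> : 0 = expR a ^+ 2 - expR (2 * a) by rewrite mulr_natl mulr2n expRD subrr.
  by apply: cvgB; [apply: cvgM|]; exact: is_cvg_series_exp_coeff.
apply: (squeeze_cvgr _ (cvg_cst 0) ecv).
near=> m; rewrite normr_ge0/=.
have := @horner_mx_le _ _ A _ i j (exp_poly_sqr_ge R m).
rewrite rmorphB rmorphXn/= !horner_mx_exp_poly scale1r !hornerE.
by rewrite !horner_exp_poly mul1r !mxE /d mxE.
Unshelve. all: by end_near. Qed.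

(** * The Horner scheme and inclusion isotonicity *)

Lemma foldr_horner (R : realType) (n : nat) (A : 'M[R]_n) (K m : nat) :
  foldr (fun k N => 1%:M + (k%:R^-1 *: A) *m N) 1%:M (iota m.+1 K) =
  \sum_(k < K.+1) (m`!%:R / (m + k)`!%:R) *: A ^+ k.
Proof.
have f0 (k : nat) : k`!%:R != 0 :> R by rewrite pnatr_eq0 -lt0n fact_gt0.
(* The starting index stays general because the inner scheme starts one index later; at [m = 0] the
   sum is the Taylor sum. *)
elim: K m => [|K ih] m /=.
  by rewrite big_ord1 addn0 divff ?scale1r.
rewrite ih [RHS]big_ord_recl addn0 divff ?scale1r//; congr (_ + _).
rewrite mulmx_sumr; apply: eq_bigr => k _.
rewrite /bump/= -scalemxAr -scalemxAl scalerA -[A *m _]/(A * A ^+ k) -exprS.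
rewrite addnS addSn factS natrM.
congr (_ *: _).
by rewrite mulrAC [m.+1%:R * _]mulrC mulfK ?pnatr_eq0.
Qed.

Lemma mx_set_imx_mul (R : realType) (n : nat) (M N : 'M[set R]_n) (A B : 'M[R]_n) :
  mx_set M A -> mx_set N B -> mx_set (imx_mul M N) (A *m B).
Proof.
move=> MA NB i j; rewrite !mxE.
elim/big_rec2 : _ => //= k x X _ Xx.
exists (A i k * B k j); last by exists x.
by exists (A i k) => //; exists (B k j).
Qed.

Lemma mx_set_imx_add (R : realType) (n : nat) (M N : 'M[set R]_n) (A B : 'M[R]_n) :
  mx_set M A -> mx_set N B -> mx_set (imx_add M N) (A + B).
Proof.
by move=> MA NB i j; rewrite !mxE; exists (A i j) => //; exists (B i j).
Qed.

Lemma mx_set_imx_div (R : realType) (n : nat) (M : 'M[set R]_n) (A : 'M[R]_n) (c : R) :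
  mx_set M A -> mx_set (imx_div M c) (c^-1 *: A).
Proof.
by move=> MA i j; rewrite !mxE; exists (A i j) => //; exists c => //; rewrite mulrC.
Qed.

Lemma mx_set_imx_of (R : realType) (n : nat) (A : 'M[R]_n) : mx_set (imx_of A) A.
Proof. by move=> i j; rewrite mxE. Qed.

Lemma mx_set_horner (R : realType) (n : nat) (M : 'M[set R]_n) (A : 'M[R]_n) (K : nat) :
  mx_set M A -> mx_set (Defs.horner M K) (expmx_psum A K.+1).
Proof.
(* Once the real sum has the same nesting as the interval scheme, membership passes through one
   operation at a time. *)
move=> MA; have -> : expmx_psum A K.+1 =
    foldr (fun k N => 1%:M + (k%:R^-1 *: A) *m N) 1%:M (iota 1 K).
  by rewrite foldr_horner; apply: eq_bigr => k _; rewrite div1r.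
rewrite /Defs.horner; elim: (iota _ _) => [|k s ih] /=; first exact: mx_set_imx_of.
apply: mx_set_imx_add; first exact: mx_set_imx_of.
exact: mx_set_imx_mul (mx_set_imx_div _ MA) ih.
Qed.

Lemma mx_set_remainder (R : realType) (n : nat) (M : 'M[set R]_n) (A : 'M[R]_n) (K : nat) :
  (forall i j, `|A i j| <= rho (imx_norm M) K) -> mx_set (remainder M K) A.
Proof.
move=> Ar i j; rewrite !mxE; have := Ar i j.
(* If [r] is 0, the quotient is 0 by convention and the bound forces the entry to be 0, so the same
   witness serves. *)
set r := rho _ _ => Arij; exists r => //; exists (A i j / r).
  have r0 : 0 <= r by exact: le_trans Arij.
  rewrite /= -ler_norml normrM normfV (ger0_norm r0).
  have [->|rn0] := eqVneq r 0; first by rewrite invr0 mulr0.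
  by rewrite ler_pdivrMr ?mul1r// lt0r rn0.
have [r0|rn0] := eqVneq r 0; last by rewrite mulrC divfK.
by move: Arij; rewrite r0 normr_le0 mul0r => /eqP ->.
Qed.

(** * Norms under scaling, and the final enclosure *)

Lemma norminf_le_imx_norm (R : realType) (n : nat) (M : 'M[set R]_n) (A : 'M[R]_n) :
  is_interval_mx M -> mx_set M A -> mx_norminf A <= imx_norm M.
Proof. by move=> /imx_norm_max[B _ [-> +]]; exact. Qed.

Lemma is_interval_mx_div (R : realType) (n : nat) (M : 'M[set R]_n) (c : R) :
  0 < c -> is_interval_mx M -> is_interval_mx (imx_div M c).
Proof.
move=> c0 Mi i j; have [a [b [ab Mab]]] := Mi i j.
exists (a / c), (b / c); split; first by rewrite ler_pM2r ?invr_gt0.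
rewrite mxE Mab; apply/seteqP; split => [_ [x /= xab [_ -> <-]]|x /=].
  by rewrite !ler_pM2r ?invr_gt0.
rewrite ler_pdivrMr// ler_pdivlMr// => xab; exists (x * c) => //.
by exists c => //; rewrite mulfK ?gt_eqF.
Qed.

(** The norm of the quotient is attained at some [B], and [c *: B] lies in [M]. *)
Lemma imx_norm_div (R : realType) (n : nat) (M : 'M[set R]_n) (c : R) :
  0 < c -> is_interval_mx M -> imx_norm (imx_div M c) <= imx_norm M / c.
Proof.
move=> c0 Mi; have [B MB [-> _]] := imx_norm_max (is_interval_mx_div c0 Mi).
have MA : mx_set M (c *: B).
  move=> i j; have := MB i j; rewrite !mxE => -[x Mx [_ -> <-]].
  by rewrite mulrC divfK ?gt_eqF.
have -> : B = c^-1 *: (c *: B) by rewrite scalerA mulVf ?scale1r ?gt_eqF.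
apply: le_trans (mx_norminfZ _ _) _; first by rewrite invr_ge0 ltW.
by rewrite mulrC ler_wpM2r ?invr_ge0 ?(ltW c0)// norminf_le_imx_norm.
Qed.

Lemma mx_set_taylor (R : realType) (n : nat) (M : 'M[set R]_n) (A : 'M[R]_n) (K : nat) :
  is_interval_mx M -> imx_norm M < K.+2%:R -> mx_set M A ->
  mx_set (taylor M K) (expmx A).
Proof.
move=> Mi MK MA.
rewrite (_ : expmx A = expmx_psum A K.+1 + (expmx A - expmx_psum A K.+1)); last first.
  by rewrite addrC subrK.
apply: mx_set_imx_add; first exact: mx_set_horner.
apply: mx_set_remainder => i j; rewrite !mxE; apply: expmx_remainder => //.
exact: norminf_le_imx_norm.
Qed.

Theorem theorem5 (R : realType) (n : nat) (A : 'M[set R]_n) (K L : nat)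
    (hA : is_interval_mx A)
    (hKL : imx_norm A < K.+2%:R * 2 ^+ L) :
  [set expmx X | X in mx_set A] `<=` mx_set (scaling_squaring A L K).
Proof.
move=> _ [X AX <-].
have c0 : 0 < 2 ^+ L :> R by rewrite exprn_gt0.
rewrite /scaling_squaring -[X](scalerK (lt0r_neq0 c0)) scalerA.
have : mx_set (taylor (imx_div A (2 ^+ L)) K) (expmx ((2 ^+ L)^-1 *: X)).
  apply: mx_set_taylor; [exact: is_interval_mx_div| |exact: mx_set_imx_div].
  by apply: le_lt_trans (imx_norm_div _ _) _ => //; rewrite ltr_pdivrMr.
(* The enclosure and the scaled matrix become arbitrary [N] and [Y], so that in the induction [L]
   only counts squarings. *)
move: (taylor _ _) => N; rewrite mulrC -scalerA.
move: (_ *: X) => Y NY; elim: L {hKL c0} => [|L ih]; first by rewrite scale1r.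
by rewrite exprS -scalerA -expmx_sqr; exact: mx_set_imx_mul.
Qed.
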